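(* Let $H$ be a weak Hopf algebra and $C$ a left partial $H$-module coalgebra via $\cdot:H\otimes C\to C$, $h\otimes c\mapsto h\cdot c$. Then the dual algebra $C^*$ is a right partial $H$-module algebra via $\leftharpoonup:C^*\otimes H\to C^*$, $\alpha\otimes h\mapsto(\alpha\leftharpoonup h)$, where $(\alpha\leftharpoonup h)(c)=\alpha(h\cdot c)$ for all $c\in C$. Moreover, if $C$ is a symmetric left partial $H$-module coalgebra, then $C^*$ is a symmetric right partial $H$-module algebra.
   Context: Everything is over a fixed field $\Bbbk$; Sweedler notation $\Delta(x)=x_1\otimes x_2$ is used. $C^*=\mathrm{Hom}(C,\Bbbk)$ is an algebra under convolution $(\alpha\beta)(c)=\alpha(c_1)\beta(c_2)$ with unit $1_{C^*}=\varepsilon$. Weak Hopf algebra: a vector space $H$ that is an algebra and a coalgebra with $\Delta(hk)=\Delta(h)\Delta(k)$; $\varepsilon(hk\ell)=\varepsilon(hk_1)\varepsilon(k_2\ell)=\varepsilon(hk_2)\varepsilon(k_1\ell)$; $(1_H\otimes\Delta(1_H))(\Delta(1_H)\otimes1_H)=(\Delta(1_H)\otimes1_H)(1_H\otimes\Delta(1_H))=\Delta^2(1_H)$; together with a linear antipode $S:H\to H$ with $h_1S(h_2)=\varepsilon_t(h)$, $S(h_1)h_2=\varepsilon_s(h)$, $S(h_1)h_2S(h_3)=S(h)$, where $\varepsilon_t(h)=\varepsilon(1_1h)1_2$, $\varepsilon_s(h)=1_1\varepsilon(h1_2)$ and $1_1\otimes1_2=\Delta(1_H)$. Left partial $H$-module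 coalgebra: a coalgebra $C$ with a linear map $\cdot:H\otimes C\to C$ such that for all $h,k\in H$, $c\in C$: $1_H\cdot c=c$; $\Delta(h\cdot c)=h_1\cdot c_1\otimes h_2\cdot c_2$; $h\cdot(k\cdot c)=(hk_1\cdot c_1)\,\varepsilon(k_2\cdot c_2)$. It is symmetric if moreover $h\cdot(k\cdot c)=\varepsilon(k_1\cdot c_1)\,(hk_2\cdot c_2)$. Right partial $H$-module algebra: an algebra $A$ with a linear map $\leftharpoonup:A\otimes H\to A$ such that for all $h,k\in H$, $a,b\in A$: $a\leftharpoonup1_H=a$; $ab\leftharpoonup h=(a\leftharpoonup h_1)(b\leftharpoonup h_2)$; $(a\leftharpoonup h)\leftharpoonup k=(a\leftharpoonup hk_1)(1_A\leftharpoonup k_2)$. It is symmetric if moreover $(a\leftharpoonup h)\leftharpoonup k=(1_A\leftharpoonup k_1)(a\leftharpoonup hk_2)$. *)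

(* Defs.v *)
From HB Require Import structures.
From mathcomp Require Import all_boot all_algebra.
From mathcomp Require Import generic_quotient.
From mathcomp Require Import boolp.

Set Implicit Arguments.
Unset Strict Implicit.
Unset Printing Implicit Defensive.

Import GRing.Theory.
Local Open Scope ring_scope.
Local Open Scope quotient_scope.

Reserved Notation "V ⊗ W" (at level 40, left associativity).
Reserved Notation "x ⋆ y" (at level 40, left associativity).
Reserved Notation "\sw_ ( x1 , x2 <- x ) E"
  (at level 41, E at level 41, x1 name, x2 name,
   format "'[' \sw_ ( x1 ,  x2  <-  x ) '/  '  E ']'").

(* The tensor product V ⊗ W of two vector spaces of arbitrary dimension.  The *)
(* sequence [:: (v_1, w_1); ...; (v_n, w_n)] stands for the formal sum of the *)
(* v_i ⊗ w_i, and V ⊗ W is the quotient of these formal sums by the least     *)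
(* congruence making ⊗ bilinear.                                              *)
Section TensorRel.
Variables (K : fieldType) (V W : lmodType K).

Inductive tensor_rel : seq (V * W) -> seq (V * W) -> Prop :=
| tensor_refl s : tensor_rel s s
| tensor_sym s t : tensor_rel s t -> tensor_rel t s
| tensor_trans s t u : tensor_rel s t -> tensor_rel t u -> tensor_rel s u
| tensor_cat s s' t t' :
    tensor_rel s t -> tensor_rel s' t' -> tensor_rel (s ++ s') (t ++ t')
| tensor_catC s t : tensor_rel (s ++ t) (t ++ s)
| tensor_0l w : tensor_rel [:: (0, w)] [::]
| tensor_Dl v v' w : tensor_rel [:: (v + v', w)] [:: (v, w); (v', w)]
| tensor_Dr v w w' : tensor_rel [:: (v, w + w')] [:: (v, w); (v, w')]
| tensor_Z a v w : tensor_rel [:: (a *: v, w)] [:: (v, a *: w)].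

Definition tensor_relb s t := `[< tensor_rel s t >].

Lemma tensor_relb_equiv : equiv_class_of tensor_relb.
Proof.
split=> [s | s t | t s u].
- by apply/asboolP; constructor.
- by apply/asboolP/asboolP => /tensor_sym.
- by move=> /asboolP st /asboolP tu; apply/asboolP/(tensor_trans st tu).
Qed.

Canonical tensor_equiv := EquivRelPack tensor_relb_equiv.

Definition tensor := {eq_quot tensor_relb}.
HB.instance Definition _ := Choice.on tensor.
HB.instance Definition _ := EqQuotient.on tensor.

End TensorRel.

Notation "V ⊗ W" := (tensor V W) : type_scope.

Section Tensor.
Variables (K : fieldType) (V W : lmodType K).
Implicit Types (s t : seq (V * W)) (x y z : tensor V W).

Definition tpi s : tensor V W := \pi s.
Definition tens (v : V) (w : W) : tensor V W := tpi [:: (v, w)].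

Lemma tpiP s t : tpi s = tpi t <-> tensor_rel s t.
Proof.
split=> [/eqmodP/asboolP // | st]; rewrite /tpi; apply/eqmodP.
by apply/asboolP.
Qed.

Lemma tpiK x : tpi (repr x) = x.
Proof. by rewrite /tpi reprK. Qed.

Definition tadd x y := tpi (repr x ++ repr y).
Definition tscale (a : K) x := tpi [seq (a *: p.1, p.2) | p <- repr x].

Lemma tensor_scale (a : K) s t : tensor_rel s t ->
  tensor_rel [seq (a *: p.1, p.2) | p <- s] [seq (a *: p.1, p.2) | p <- t].
Proof.
elim=> {s t} /=.
- by move=> s; constructor.
- by move=> s t _; apply: tensor_sym.
- by move=> s t u _ st _; apply: tensor_trans st.
- by move=> s s' t t' _ st _ st'; rewrite !map_cat; apply: tensor_cat.
- by move=> s t; rewrite !map_cat; apply: tensor_catC.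
- by move=> w; rewrite scaler0; apply: tensor_0l.
- by move=> v v' w; rewrite scalerDr; apply: tensor_Dl.
- by move=> v w w'; apply: tensor_Dr.
- by move=> b v w; rewrite scalerA mulrC -scalerA; apply: tensor_Z.
Qed.

Lemma tadd_pi s t : tadd (tpi s) (tpi t) = tpi (s ++ t).
Proof. by apply/tpiP/tensor_cat; apply/tpiP; rewrite tpiK. Qed.

Lemma tscale_pi a s : tscale a (tpi s) = tpi [seq (a *: p.1, p.2) | p <- s].
Proof. by apply/tpiP/tensor_scale; apply/tpiP; rewrite tpiK. Qed.

Lemma tpi_cons p s : tpi (p :: s) = tadd (tens p.1 p.2) (tpi s).
Proof. by rewrite tadd_pi; case: p. Qed.

Lemma taddA : associative tadd.
Proof.
move=> x y z; rewrite -(tpiK x) -(tpiK y) -(tpiK z).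
by rewrite !tadd_pi catA.
Qed.

Lemma taddC : commutative tadd.
Proof. by move=> x y; apply/tpiP/tensor_catC. Qed.

Lemma tadd0 : left_id (tpi [::]) tadd.
Proof. by move=> x; rewrite -(tpiK x) tadd_pi. Qed.

Lemma tscaleDr a : {morph tscale a : x y / tadd x y}.
Proof.
move=> x y; rewrite -(tpiK x) -(tpiK y).
by rewrite tadd_pi !tscale_pi tadd_pi map_cat.
Qed.

Lemma tens0l w : tens 0 w = tpi [::].
Proof. exact/tpiP/tensor_0l. Qed.

Lemma tens_Dl v v' w : tens (v + v') w = tadd (tens v w) (tens v' w).
Proof. by rewrite tadd_pi; apply/tpiP/tensor_Dl. Qed.

Lemma tens_Dr v w w' : tens v (w + w') = tadd (tens v w) (tens v w').
Proof. by rewrite tadd_pi; apply/tpiP/tensor_Dr. Qed.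

Lemma tscale_tens a v w : tscale a (tens v w) = tens (a *: v) w.
Proof. by rewrite tscale_pi. Qed.

Lemma tensor_ind_cons (P : tensor V W -> Prop) :
  P (tpi [::]) -> (forall v w x, P x -> P (tadd (tens v w) x)) ->
  forall x, P x.
Proof.
move=> P0 PD x; rewrite -(tpiK x).
by elim: (repr x) => // p s Ps; rewrite tpi_cons; apply: PD.
Qed.

Lemma tscale0 a : tscale a (tpi [::]) = tpi [::].
Proof. by rewrite tscale_pi. Qed.

Lemma tscaleDl x a b : tscale (a + b) x = tadd (tscale a x) (tscale b x).
Proof.
elim/tensor_ind_cons: x => [|v w x IHx]; first by rewrite !tscale0 tadd0.
rewrite !tscaleDr !tscale_tens scalerDl tens_Dl IHx -!taddA.
by congr tadd; rewrite !taddA; congr tadd; rewrite taddC.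
Qed.

Lemma taddN : left_inverse (tpi [::]) (tscale (- 1)) tadd.
Proof.
elim/tensor_ind_cons => [|v w x IHx]; first by rewrite tscale0 tadd0.
rewrite tscaleDr tscale_tens scaleN1r taddA -(taddA (tens _ _)).
rewrite [tadd (tscale _ _) _]taddC taddA -tens_Dl addNr tens0l tadd0.
by rewrite IHx.
Qed.

HB.instance Definition _ := GRing.isZmodule.Build (tensor V W)
  taddA taddC tadd0 taddN.

Lemma tscaleA a b x : tscale a (tscale b x) = tscale (a * b) x.
Proof.
elim/tensor_ind_cons: x => [|v w x IHx]; first by rewrite !tscale0.
by rewrite !tscaleDr !tscale_tens scalerA IHx.
Qed.

Lemma tscale1 : left_id 1 tscale.
Proof.
elim/tensor_ind_cons => [|v w x IHx]; first by rewrite tscale0.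
by rewrite tscaleDr tscale_tens scale1r IHx.
Qed.

HB.instance Definition _ := GRing.Zmodule_isLmodule.Build K (tensor V W)
  tscaleA tscale1 tscaleDr tscaleDl.

End Tensor.

Notation "v ⊗ w" := (tens v w) : ring_scope.

Section TensorLift.
Variables (K : fieldType) (V W : lmodType K).

Lemma tensDl (w : W) : {morph (fun v : V => v ⊗ w) : v v' / v + v'}.
Proof. by move=> v v'; apply: tens_Dl. Qed.

Lemma tensDr (v : V) : {morph (fun w : W => v ⊗ w) : w w' / w + w'}.
Proof. by move=> w w'; apply: tens_Dr. Qed.

Lemma tensZl a (v : V) (w : W) : (a *: v) ⊗ w = a *: (v ⊗ w).
Proof. by rewrite -tscale_tens. Qed.

Lemma tensZr a (v : V) (w : W) : v ⊗ (a *: w) = a *: (v ⊗ w).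
Proof. by rewrite -tensZl; apply/tpiP/tensor_sym/tensor_Z. Qed.

Definition bilinear (U : lmodType K) (f : V -> W -> U) : Prop :=
  (forall w, linear (f ^~ w)) /\ (forall v, linear (f v)).

Lemma tens_bilinear : bilinear (@tens K V W).
Proof.
by split=> [w a v v' | v a w w'] /=; rewrite (tensDl, tensDr) (tensZl, tensZr).
Qed.

Lemma tpi_sum (s : seq (V * W)) : tpi s = \sum_(p <- s) p.1 ⊗ p.2.
Proof. by elim: s => [|p s IHs]; rewrite ?big_nil // big_cons -IHs tpi_cons. Qed.

Lemma tensor_sum (x : V ⊗ W) : x = \sum_(p <- repr x) p.1 ⊗ p.2.
Proof. by rewrite -tpi_sum tpiK. Qed.

Lemma tensor_ind (P : V ⊗ W -> Prop) :
  P 0 -> (forall v w x, P x -> P (v ⊗ w + x)) -> forall x, P x.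
Proof. exact: tensor_ind_cons. Qed.

(* The linear map V ⊗ W -> U induced by a bilinear map f.  The formula picks  *)
(* some presentation of x as a sum of pure tensors; tlift_pi shows that the   *)
(* choice is immaterial as soon as f is bilinear.                             *)
Definition tlift (U : nmodType) (f : V -> W -> U) (x : V ⊗ W) : U :=
  \sum_(p <- repr x) f p.1 p.2.

Section Bilinear.
Variables (U : lmodType K) (f : V -> W -> U).
Hypothesis f_bilinear : bilinear f.

Lemma bilinear0l w : f 0 w = 0.
Proof.
by have := f_bilinear.1 w (-1) 0 0; rewrite /= scaler0 add0r scaleN1r addNr.
Qed.

Lemma bilinear0r v : f v 0 = 0.
Proof.
by have := f_bilinear.2 v (-1) 0 0; rewrite /= scaler0 add0r scaleN1r addNr.
Qed.

Lemma bilinearZl a v w : f (a *: v) w = a *: f v w.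
Proof. by have := f_bilinear.1 w a v 0; rewrite /= !addr0 bilinear0l addr0. Qed.

Lemma bilinearZr a v w : f v (a *: w) = a *: f v w.
Proof. by have := f_bilinear.2 v a w 0; rewrite /= !addr0 bilinear0r addr0. Qed.

Lemma bilinearDl v v' w : f (v + v') w = f v w + f v' w.
Proof. by have := f_bilinear.1 w 1 v v'; rewrite /= !scale1r. Qed.

Lemma bilinearDr v w w' : f v (w + w') = f v w + f v w'.
Proof. by have := f_bilinear.2 v 1 w w'; rewrite /= !scale1r. Qed.

Lemma tlift_rel s t : tensor_rel s t ->
  \sum_(p <- s) f p.1 p.2 = \sum_(p <- t) f p.1 p.2.
Proof.
elim=> {s t} //.
- by move=> s t u _ -> _.
- by move=> s s' t t' _ ss' _ tt'; rewrite !big_cat /= ss' tt'.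
- by move=> s t; rewrite !big_cat /= addrC.
- by move=> w; rewrite big_seq1 big_nil /= bilinear0l.
- by move=> v v' w; rewrite !big_cons !big_nil /= !addr0 bilinearDl.
- by move=> v w w'; rewrite !big_cons !big_nil /= !addr0 bilinearDr.
- by move=> a v w; rewrite !big_seq1 /= bilinearZl bilinearZr.
Qed.

Lemma tlift_pi s : tlift f (tpi s) = \sum_(p <- s) f p.1 p.2.
Proof. by apply: tlift_rel; apply/tpiP; rewrite tpiK. Qed.

Lemma tlift_tens v w : tlift f (v ⊗ w) = f v w.
Proof. by rewrite tlift_pi big_seq1. Qed.

Lemma tlift_linear : linear (tlift f).
Proof.
have lZ a x : tlift f (a *: x) = a *: tlift f x.
  rewrite -[x]tpiK [a *: _](tscale_pi a) !tlift_pi scaler_sumr big_map.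
  by apply: eq_bigr => p _; apply: bilinearZl.
move=> a x y; rewrite -lZ -[_ *: x]tpiK -[y]tpiK.
by rewrite [_ + _]tadd_pi !tlift_pi big_cat.
Qed.

End Bilinear.

Lemma raddf_tlift (U U' : nmodType) (g : {additive U -> U'})
    (f : V -> W -> U) (x : V ⊗ W) :
  g (tlift f x) = tlift (fun v w => g (f v w)) x.
Proof. by rewrite /tlift raddf_sum. Qed.

Lemma eq_tlift (U : nmodType) (f g : V -> W -> U) (x : V ⊗ W) :
  f =2 g -> tlift f x = tlift g x.
Proof. by move=> fg; apply: eq_bigr => p _; apply: fg. Qed.

End TensorLift.

(* Unital associative algebras.  The library's algType requires 1 <> 0, which *)
(* would exclude the dual of the zero coalgebra.                              *)
HB.mixin Record Lmodule_isAssocAlgebra (K : fieldType) A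
    of GRing.Lmodule K A := {
  amul : A -> A -> A;
  aone : A;
  amul_bilinear : bilinear amul;
  amulA : associative amul;
  amul1l : left_id aone amul;
  amul1r : right_id aone amul
}.
#[short(type="assocAlgType")]
HB.structure Definition AssocAlgebra (K : fieldType) :=
  {A of GRing.Lmodule K A & Lmodule_isAssocAlgebra K A}.

Notation "x ⋆ y" := (amul x y) : ring_scope.

HB.mixin Record Lmodule_hasComul (K : fieldType) C of GRing.Lmodule K C := {
  comul : {linear C -> (C ⊗ C)%type};
  counit : {scalar C}
}.
HB.structure Definition PreCoalgebra (K : fieldType) :=
  {C of GRing.Lmodule K C & Lmodule_hasComul K C}.

Definition sweedler (K : fieldType) (C : PreCoalgebra.type K) (U : nmodType)
  (x : C) (f : C -> C -> U) : U := tlift f (comul x).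

(* Sweedler notation for Δ(x) = x_1 ⊗ x_2; E must be bilinear in (x_1, x_2).  *)
Notation "\sw_ ( x1 , x2 <- x ) E" :=
  (sweedler x (fun x1 x2 => E)) : ring_scope.

HB.mixin Record PreCoalgebra_isCoalgebra (K : fieldType) C
    of PreCoalgebra K C := {
  comulA : forall x : C,
    \sw_(x1, x2 <- x) \sw_(x11, x12 <- x1) x11 ⊗ (x12 ⊗ x2) =
    \sw_(x1, x2 <- x) \sw_(x21, x22 <- x2) x1 ⊗ (x21 ⊗ x22);
  counitl : forall x : C, \sw_(x1, x2 <- x) counit x1 *: x2 = x;
  counitr : forall x : C, \sw_(x1, x2 <- x) counit x2 *: x1 = x
}.
#[short(type="coalgType")]
HB.structure Definition Coalgebra (K : fieldType) :=
  {C of PreCoalgebra K C & PreCoalgebra_isCoalgebra K C}.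

(* comul1l and comul1r are (1 ⊗ Δ(1))(Δ(1) ⊗ 1) = Δ²(1) and                  *)
(* (Δ(1) ⊗ 1)(1 ⊗ Δ(1)) = Δ²(1), with the products in the tensor cube of H    *)
(* computed componentwise from Δ(1) = u1 ⊗ u2 and Δ(1) = e1 ⊗ e2.             *)
HB.mixin Record isWeakBialgebra (K : fieldType) H
    of AssocAlgebra K H & Coalgebra K H := {
  comulM : forall h k : H, comul (h ⋆ k) =
    \sw_(h1, h2 <- h) \sw_(k1, k2 <- k) (h1 ⋆ k1) ⊗ (h2 ⋆ k2);
  counitMl : forall h k l : H,
    counit (h ⋆ k ⋆ l) = \sw_(k1, k2 <- k) counit (h ⋆ k1) * counit (k2 ⋆ l);
  counitMr : forall h k l : H,
    counit (h ⋆ k ⋆ l) = \sw_(k1, k2 <- k) counit (h ⋆ k2) * counit (k1 ⋆ l);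
  comul1l :
    \sw_(u1, u2 <- (aone : H)) \sw_(e1, e2 <- (aone : H)) u1 ⊗ ((e1 ⋆ u2) ⊗ e2) =
    \sw_(u1, u2 <- (aone : H)) \sw_(u21, u22 <- u2) u1 ⊗ (u21 ⊗ u22);
  comul1r :
    \sw_(u1, u2 <- (aone : H)) \sw_(e1, e2 <- (aone : H)) u1 ⊗ ((u2 ⋆ e1) ⊗ e2) =
    \sw_(u1, u2 <- (aone : H)) \sw_(u21, u22 <- u2) u1 ⊗ (u21 ⊗ u22)
}.
#[short(type="weakBialgType")]
HB.structure Definition WeakBialgebra (K : fieldType) :=
  {H of AssocAlgebra K H & Coalgebra K H & isWeakBialgebra K H}.

Section CounitalMaps.
Variables (K : fieldType) (H : weakBialgType K).

Definition eps_t (h : H) : H :=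
  \sw_(u1, u2 <- (aone : H)) counit (u1 ⋆ h) *: u2.
Definition eps_s (h : H) : H :=
  \sw_(u1, u2 <- (aone : H)) counit (h ⋆ u2) *: u1.

End CounitalMaps.

HB.mixin Record WeakBialgebra_hasAntipode (K : fieldType) H
    of WeakBialgebra K H := {
  antipode : {linear H -> H};
  antipode_t : forall h : H, \sw_(h1, h2 <- h) h1 ⋆ antipode h2 = eps_t h;
  antipode_s : forall h : H, \sw_(h1, h2 <- h) antipode h1 ⋆ h2 = eps_s h;
  antipodeE : forall h : H,
    \sw_(h1, h' <- h) \sw_(h2, h3 <- h') antipode h1 ⋆ h2 ⋆ antipode h3 =
    antipode h
}.
#[short(type="weakHopfAlgType")]
HB.structure Definition WeakHopfAlgebra (K : fieldType) :=
  {H of WeakBialgebra K H & WeakBialgebra_hasAntipode K H}.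

Section PartialModules.
Variables (K : fieldType) (H : weakHopfAlgType K).

Section LeftCoalgebra.
Variables (C : coalgType K) (act : {linear (H ⊗ C)%type -> C}).
Local Notation "h · c" := (act (h ⊗ c)) (at level 35, right associativity).

Definition left_partial_module_coalgebra : Prop :=
  [/\ forall c, aone · c = c,
      forall h c, comul (h · c) =
        \sw_(h1, h2 <- h) \sw_(c1, c2 <- c) (h1 · c1) ⊗ (h2 · c2)
    & forall h k c, h · (k · c) =
        \sw_(k1, k2 <- k) \sw_(c1, c2 <- c)
          counit (k2 · c2) *: ((h ⋆ k1) · c1)].

Definition symmetric_left_partial_module_coalgebra : Prop :=
  left_partial_module_coalgebra /\
  forall h k c, h · (k · c) =
    \sw_(k1, k2 <- k) \sw_(c1, c2 <- c) counit (k1 · c1) *: ((h ⋆ k2) · c2).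

End LeftCoalgebra.

Section RightAlgebra.
Variables (A : assocAlgType K) (act : {linear (A ⊗ H)%type -> A}).
Local Notation "a ↼ h" := (act (a ⊗ h)) (at level 39, left associativity).

Definition right_partial_module_algebra : Prop :=
  [/\ forall a, a ↼ aone = a,
      forall a b h, (a ⋆ b) ↼ h = \sw_(h1, h2 <- h) (a ↼ h1) ⋆ (b ↼ h2)
    & forall a h k, (a ↼ h) ↼ k =
        \sw_(k1, k2 <- k) (a ↼ (h ⋆ k1)) ⋆ (aone ↼ k2)].

Definition symmetric_right_partial_module_algebra : Prop :=
  right_partial_module_algebra /\
  forall a h k, (a ↼ h) ↼ k = \sw_(k1, k2 <- k) (aone ↼ k1) ⋆ (a ↼ (h ⋆ k2)).

End RightAlgebra.
End PartialModules.

Definition dual (K : fieldType) (C : lmodType K) := {scalar C}.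
Identity Coercion linear_of_dual : dual >-> GRing.Linear.type.

Section DualSpace.
Variables (K : fieldType) (C : lmodType K).
Implicit Types (f g : dual C) (a : K).

HB.instance Definition _ := gen_eqMixin (dual C).
HB.instance Definition _ := gen_choiceMixin (dual C).

Lemma dualP f g : f =1 g -> f = g.
Proof.
case: f g => [f [[cf] [sf]]] [g [[cg] [sg]]] /= /funext fg.
move: cf sf; rewrite fg => cf sf.
by rewrite (Prop_irrelevance cf cg) (Prop_irrelevance sf sg).
Qed.

Definition dual0 : dual C := \0.
Definition dual_add f g : dual C := f \+ g.
Definition dual_opp f : dual C := \- f.
Definition dual_scale_fun a f (c : C) := a * f c.

Lemma dual_scale_scalar a f : scalar (dual_scale_fun a f).
Proof. by move=> b x y; rewrite /dual_scale_fun linearP mulrDr mulrCA. Qed.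

HB.instance Definition _ a f :=
  GRing.isLinear.Build K C K *%R (dual_scale_fun a f) (dual_scale_scalar a f).

Definition dual_scale a f : dual C := dual_scale_fun a f.

Lemma dual_addA : associative dual_add.
Proof. by move=> f g h; apply: dualP => x; apply: addrA. Qed.

Lemma dual_addC : commutative dual_add.
Proof. by move=> f g; apply: dualP => x; apply: addrC. Qed.

Lemma dual_add0 : left_id dual0 dual_add.
Proof. by move=> f; apply: dualP => x; apply: add0r. Qed.

Lemma dual_addN : left_inverse dual0 dual_opp dual_add.
Proof. by move=> f; apply: dualP => x; apply: addNr. Qed.

HB.instance Definition _ := GRing.isZmodule.Build (dual C)
  dual_addA dual_addC dual_add0 dual_addN.

Lemma dual_scaleA a b f : dual_scale a (dual_scale b f) = dual_scale (a * b) f.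
Proof. by apply: dualP => x; apply: mulrA. Qed.

Lemma dual_scale1 : left_id 1 dual_scale.
Proof. by move=> f; apply: dualP => x; apply: mul1r. Qed.

Lemma dual_scaleDr : right_distributive dual_scale +%R.
Proof. by move=> a f g; apply: dualP => x; apply: mulrDr. Qed.

Lemma dual_scaleDl f : {morph dual_scale^~ f : a b / a + b}.
Proof. by move=> a b; apply: dualP => x; apply: mulrDl. Qed.

HB.instance Definition _ := GRing.Zmodule_isLmodule.Build K (dual C)
  dual_scaleA dual_scale1 dual_scaleDr dual_scaleDl.

Lemma dual_addE f g x : (f + g) x = f x + g x. Proof. by []. Qed.

Lemma dual_scaleE a f x : (a *: f) x = a * f x. Proof. by []. Qed.

End DualSpace.

Section Convolution.
Variables (K : fieldType) (C : coalgType K).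
Implicit Types (f g h : dual C).

Definition conv_fun f g (c : C) : K := \sw_(c1, c2 <- c) f c1 * g c2.

Lemma conv_bilinear f g : bilinear (fun c1 c2 : C => f c1 * g c2 : K^o).
Proof.
split=> [c2 a c c' | c1 a c c'] /=; rewrite linearP.
  by rewrite mulrDl /GRing.scale /= mulrA.
by rewrite mulrDr /GRing.scale /= mulrCA.
Qed.

Lemma conv_fun_scalar f g : scalar (conv_fun f g).
Proof.
move=> a x y; rewrite /conv_fun /sweedler linearP.
exact: (tlift_linear (conv_bilinear f g)).
Qed.

HB.instance Definition _ f g :=
  GRing.isLinear.Build K C K *%R (conv_fun f g) (conv_fun_scalar f g).

Definition conv f g : dual C := conv_fun f g.
Definition conv1 : dual C := @counit K C.

Lemma conv_mul_bilinear : bilinear conv.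
Proof.
split=> [g a f f' | f a g g']; apply: dualP => c;
  rewrite dual_addE dual_scaleE /= /conv_fun /sweedler /tlift mulr_sumr;
  rewrite -big_split; apply: eq_bigr => p _.
  by rewrite dual_addE dual_scaleE mulrDl mulrA.
by rewrite dual_addE dual_scaleE mulrDr mulrCA.
Qed.

Lemma conv3_bilinear f g h : bilinear (fun (x : C) (t : C ⊗ C) =>
  f x * tlift (fun y z => g y * h z) t : K^o).
Proof.
have gh := tlift_linear (conv_bilinear g h).
split=> [t a x x' | x a t t'] /=; first by rewrite linearP mulrDl -mulrA.
by rewrite gh mulrDr /GRing.scale /= mulrCA.
Qed.

Lemma convA : associative conv.
Proof.
move=> f g h; apply: dualP => c /=.
pose F (x : C) (t : C ⊗ C) : K^o := f x * tlift (fun y z => g y * h z) t.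
have Fb : bilinear F by apply: conv3_bilinear.
have Flin := tlift_linear Fb.
pose FL : {linear (C ⊗ (C ⊗ C))%type -> K^o} :=
  HB.pack (tlift F) (GRing.isLinear.Build K _ K^o *:%R (tlift F) Flin).
have FE x y z : tlift F (x ⊗ (y ⊗ z)) = f x * (g y * h z).
  by rewrite (tlift_tens Fb) /F (tlift_tens (conv_bilinear g h)).
have := congr1 FL (comulA c); rewrite /sweedler !raddf_tlift => FA.
rewrite /conv_fun /sweedler; transitivity
    (tlift (fun x1 x2 => FL (tlift (fun x11 x12 => x11 ⊗ (x12 ⊗ x2))
                               (comul x1))) (comul c)).
  rewrite FA; apply: eq_tlift => x1 x2; rewrite raddf_tlift /=.
  rewrite /conv_fun /sweedler {1}/tlift mulr_sumr.
  by apply: eq_bigr => p _; rewrite FE.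
apply: eq_tlift => x1 x2; rewrite raddf_tlift /= /conv_fun /sweedler.
rewrite [in RHS]/tlift mulr_suml; apply: eq_bigr => p _.
by rewrite FE mulrA.
Qed.

Lemma conv1l : left_id conv1 conv.
Proof.
move=> f; apply: dualP => c /=; rewrite /conv_fun -[in RHS](counitl c).
by rewrite /sweedler raddf_tlift; apply: eq_tlift => c1 c2 /=; rewrite linearZ.
Qed.

Lemma conv1r : right_id conv1 conv.
Proof.
move=> f; apply: dualP => c /=; rewrite /conv_fun -[in RHS](counitr c).
by rewrite /sweedler raddf_tlift; apply: eq_tlift => c1 c2 /=; rewrite linearZ mulrC.
Qed.

HB.instance Definition _ := Lmodule_isAssocAlgebra.Build K (dual C)
  conv_mul_bilinear convA conv1l conv1r.

End Convolution.

(* Main.v *)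
From HB Require Import structures.
Require Import Defs.
From mathcomp Require Import all_boot all_algebra.

Import GRing.Theory.
Local Open Scope ring_scope.

(** The action is the transpose of [c ↦ h · c], so each axiom for the dual, evaluated at [c], is a
    functional applied to the matching axiom of [C]. Applying [f ⊗ g] to Δ(h · c) gives the rule for
    convolution products; applying [f] to h · (k · c) gives the partial associativity, since the
    unit of the dual is the counit. [tlift_tlift] and [tlift_dualE] move functionals and evaluation
    through Sweedler sums. *)

Lemma tlift_dualE {K : fieldType} {V W C : lmodType K} (F : V -> W -> dual C)
    (x : (V ⊗ W)%type) (c : C) :
  tlift F x c = tlift (fun v w => F v w c) x.
Proof. exact: (big_morph (fun f : dual C => f c)). Qed.

(** Bilinearity of [f] makes [tlift f] linear, so it commutes with the finite sum that defines
    [tlift F x]. *)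
Lemma tlift_tlift {K : fieldType} {V W V' W' U : lmodType K}
    {f : V -> W -> U} (f_bilinear : Defs.bilinear f)
    (F : V' -> W' -> (V ⊗ W)%type) (x : (V' ⊗ W')%type) :
  tlift f (tlift F x) = tlift (fun v w => tlift f (F v w)) x.
Proof.
pose L : {linear (V ⊗ W)%type -> U} := HB.pack (tlift f)
  (GRing.isLinear.Build K _ U *:%R (tlift f) (tlift_linear f_bilinear)).
exact: (raddf_tlift L).
Qed.

Section DualAction.
Context {K : fieldType} {H C : lmodType K}.
Implicit Types (act : {linear (H ⊗ C)%type -> C}) (f : dual C) (h : H).

Definition dual_act_fun act f h (c : C) : K := f (act (h ⊗ c)).

Lemma dual_act_scalar act f h : scalar (dual_act_fun act f h).
Proof. by move=> a c c'; rewrite /dual_act_fun tensDr tensZr !linearP. Qed.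

HB.instance Definition _ act f h :=
  GRing.isLinear.Build K C K *%R (dual_act_fun act f h)
    (dual_act_scalar act f h).

Definition dual_act act f h : dual C := dual_act_fun act f h.

Lemma dual_act_bilinear act : Defs.bilinear (dual_act act).
Proof.
(* Linearity in [f] holds by computation, the operations of the dual being pointwise; linearity in
   [h] uses that of [act] and [f]. *)
split=> [h a f f' | f a h h']; apply: dualP => c //.
by rewrite dual_addE dual_scaleE /= /dual_act_fun tensDl tensZl !linearP.
Qed.

(** The module algebra axioms expect a linear map on the tensor product, hence the passage from the
    bilinear [dual_act] through [tlift]. *)
Definition dual_ract act : {linear (dual C ⊗ H)%type -> dual C} :=
  HB.pack (tlift (dual_act act))
    (GRing.isLinear.Build K _ (dual C) *:%R (tlift (dual_act act))
      (tlift_linear (dual_act_bilinear act))).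

Lemma dual_ractE act f h c : dual_ract act (f ⊗ h) c = f (act (h ⊗ c)).
Proof. by rewrite /dual_ract /= (tlift_tens (dual_act_bilinear act)). Qed.

End DualAction.

Section DualModuleAlgebra.
Context {K : fieldType} {H : weakHopfAlgType K} {C : coalgType K}.
Context {act : {linear (H ⊗ C)%type -> C}}.

Lemma dual_right_partial_module_algebra :
  left_partial_module_coalgebra act ->
  right_partial_module_algebra (dual_ract act).
Proof.
case=> act1 actD actA; split=> [f | f g h | f h k]; apply: dualP => c.
- by rewrite dual_ractE act1.
- rewrite dual_ractE /= /conv_fun {1}/sweedler actD.
  (* The form induced by [f ⊗ g] crosses the sum over [h] here, then the one over [c]. *)
  rewrite /sweedler (tlift_tlift (conv_bilinear f g)) tlift_dualE.
  apply: eq_tlift => h1 h2.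
  rewrite (tlift_tlift (conv_bilinear f g)).
  apply: eq_tlift => c1 c2.
  by rewrite (tlift_tens (conv_bilinear f g)) !dual_ractE.
(* The scalar ε(k2 · c2) is the value at [c2] of [aone ↼ k2]; linearity of [f] brings it out on the
   left, and [mulrC] moves it to the right factor. *)
- rewrite !dual_ractE actA /sweedler raddf_tlift tlift_dualE.
  apply: eq_tlift => k1 k2; rewrite raddf_tlift; apply: eq_tlift => c1 c2.
  by rewrite /= linearZ !dual_ractE mulrC.
Qed.

Lemma dual_symmetric_right_partial_module_algebra :
  symmetric_left_partial_module_coalgebra act ->
  symmetric_right_partial_module_algebra (dual_ract act).
Proof.
case=> /dual_right_partial_module_algebra ractP actA; split=> // f h k.
apply: dualP => c; rewrite !dual_ractE actA /sweedler raddf_tlift tlift_dualE.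
apply: eq_tlift => k1 k2; rewrite raddf_tlift; apply: eq_tlift => c1 c2.
(* Here ε(k1 · c1) already stands on the left, as the symmetric axiom requires. *)
by rewrite /= linearZ !dual_ractE.
Qed.

End DualModuleAlgebra.

Theorem mainTheorem2 (K : fieldType) (H : weakHopfAlgType K) (C : coalgType K)
    (act : {linear (H ⊗ C)%type -> C}) :
  left_partial_module_coalgebra act ->
  exists ract : {linear (dual C ⊗ H)%type -> dual C},
    [/\ forall (f : dual C) (h : H) (c : C), ract (f ⊗ h) c = f (act (h ⊗ c)),
        right_partial_module_algebra ract
      & symmetric_left_partial_module_coalgebra act ->
        symmetric_right_partial_module_algebra ract].
Proof.
move=> actP; exists (dual_ract act); split.
- exact: dual_ractE.
- exact: dual_right_partial_module_algebra.
- exact: dual_symmetric_right_partial_module_algebra.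
Qed.
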